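(* Let $\mathcal{C}$ be a pivotal $\Bbbk$-category. If $t=\{t_X\}_{X\in\mathcal{O}}$ is a spherical trace on a class $\mathcal{O}$ of objects of $\mathcal{C}$, then there exists a unique trace $\mathsf{t}$ on $\mathcal{I}_{\mathcal O}$ such that $\mathsf{t}_{|\mathcal{O}}=t$, i.e. $\mathsf{t}_X=t_X$ for all $X\in\mathcal{O}$.
   Context: $\Bbbk$ is a commutative ring. Pivotal categories. A pivotal category is a strict monoidal category $\mathcal{C}$ with unit $\mathbf{1}$ in which every object $X$ has a dual object $X^*$ and morphisms $\mathrm{ev}_X:X^*\otimes X\to\mathbf{1}$, $\mathrm{coev}_X:\mathbf{1}\to X\otimes X^*$, $\widetilde{\mathrm{ev}}_X:X\otimes X^*\to\mathbf{1}$, $\widetilde{\mathrm{coev}}_X:\mathbf{1}\to X^*\otimes X$ such that $(\mathrm{ev}_X,\mathrm{coev}_X)$ is a left duality, $(\widetilde{\mathrm{ev}}_X,\widetilde{\mathrm{coev}}_X)$ is a right duality, and the induced left and right dual functors coincide as monoidal functors; $f^*:Y^*\to X^*$ denotes the dual of $f:X\to Y$. The pivotal structure is the monoidal natural isomorphism $\phi_X=(\widetilde{\mathrm{ev}}_X\otimes\mathrm{id}_{X^{**}})(\mathrm{id}_X\otimes\mathrm{coev}_{X^*}):X\to X^{**}$. A pivotal $\Bbbk$-category is a pivotal category whose hom-sets are $\Bbbk$-modules, whose composition and monoidal product of morphisms are $\Bbbk$-bilinear, and such that $\mathrm{End}_{\mathcal C}(\mathbf{1})$ is a free $\Bbbk$-module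 of rank one. Partial traces. For $f\in\mathrm{Hom}_{\mathcal C}(X\otimes Y,X\otimes Z)$, $\mathrm{tr}_l^X(f)=(\mathrm{ev}_X\otimes\mathrm{id}_Z)(\mathrm{id}_{X^*}\otimes f)(\widetilde{\mathrm{coev}}_X\otimes\mathrm{id}_Y)\in\mathrm{Hom}_{\mathcal C}(Y,Z)$. For $g\in\mathrm{Hom}_{\mathcal C}(Y\otimes X,Z\otimes X)$, $\mathrm{tr}_r^X(g)=(\mathrm{id}_Z\otimes\widetilde{\mathrm{ev}}_X)(g\otimes\mathrm{id}_{X^*})(\mathrm{id}_Y\otimes\mathrm{coev}_X)\in\mathrm{Hom}_{\mathcal C}(Y,Z)$. Ideals and traces. An object $U$ is a retract of $X$ if there are $p:X\to U$, $q:U\to X$ with $pq=\mathrm{id}_U$. An ideal of $\mathcal{C}$ is a class $\mathcal{I}$ of objects closed under retracts and such that $Y\otimes X\in\mathcal{I}$ and $X\otimes Y\in\mathcal{I}$ for all $X\in\mathcal{I}$, $Y\in\mathcal{C}$. A trace on an ideal $\mathcal{I}$ is a family of $\Bbbk$-linear forms $\mathsf{t}=\{\mathsf{t}_X:\mathrm{End}_{\mathcal C}(X)\to\Bbbk\}_{X\in\mathcal{I}}$ such that $\mathsf{t}_V(gh)=\mathsf{t}_U(hg)$ for all $U,V\in\mathcal{I}$, $g:U\to V$, $h:V\to U$, and, for all $X\in\mathcal{I}$, $Y\in\mathcal{C}$: $\mathsf{t}_{Y\otimes X}(f)=\mathsf{t}_X(\mathrm{tr}_l^Y(f))$ for all $f\in\mathrm{End}_{\mathcal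 C}(Y\otimes X)$ and $\mathsf{t}_{X\otimes Y}(f)=\mathsf{t}_X(\mathrm{tr}_r^Y(f))$ for all $f\in\mathrm{End}_{\mathcal C}(X\otimes Y)$. $\mathcal{I}_{\mathcal O}$ is the class of retracts of objects $Y\otimes X\otimes Z$ with $X\in\mathcal{O}$, $Y,Z\in\mathcal{C}$ (the smallest ideal containing $\mathcal{O}$). Spherical traces. A family of $\Bbbk$-linear forms $t=\{t_X:\mathrm{End}_{\mathcal C}(X)\to\Bbbk\}_{X\in\mathcal{O}}$ is a spherical trace on $\mathcal{O}$ if it satisfies the following condition: $$t_X\bigl(\phi_X^{-1}(\mathrm{tr}_l^{X'\otimes Y}(f))^*\phi_X\bigr)=t_{X'}\bigl(\mathrm{tr}_r^{Y\otimes X^*}(f)\bigr)$$ for all $X,X'\in\mathcal{O}$, $Y\in\mathcal{C}$, $f\in\mathrm{End}_{\mathcal C}(X'\otimes Y\otimes X^* )$; this is equivalent to the condition $$t_X\bigl(\phi_X^{-1}(\mathrm{tr}_r^{Y\otimes X'}(g))^*\phi_X\bigr)=t_{X'}\bigl(\mathrm{tr}_l^{X^*\otimes Y}(g)\bigr)$$ for all $X,X'\in\mathcal{O}$, $Y\in\mathcal{C}$, $g\in\mathrm{End}_{\mathcal C}(X^*\otimes Y\otimes X')$. *)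

(* Defs.v *)
From HB Require Import structures.
From mathcomp Require Import all_boot all_algebra boolp.

Set Implicit Arguments.
Unset Strict Implicit.
Unset Printing Implicit Defensive.
Import GRing.Theory.
Local Open Scope ring_scope.

(** * Strict monoidal k-categories *)

Record linear_category (k : comPzRingType) := LinearCategory {
  obj :> Type;
  hom : obj -> obj -> lmodType k;
  idm : forall X, hom X X;
  comp : forall X Y Z, hom Y Z -> hom X Y -> hom X Z;
  comp1m : forall X Y (f : hom X Y), comp (idm Y) f = f;
  compm1 : forall X Y (f : hom X Y), comp f (idm X) = f;
  compA : forall X Y Z W (h : hom Z W) (g : hom Y Z) (f : hom X Y),
    comp h (comp g f) = comp (comp h g) f;
  comp_linearr : forall X Y Z (g : hom Y Z), linear (@comp X Y Z g);
  comp_linearl : forall X Y Z (f : hom X Y),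
    linear (fun g : hom Y Z => comp g f)
}.
Arguments hom {k l} X Y.
Arguments idm {k l} X.

Declare Scope cat_scope.
Delimit Scope cat_scope with cat.
Open Scope cat_scope.

Notation "g ∘ f" := (comp g f) (at level 41, right associativity) : cat_scope.
Notation End X := (hom X X).

(* In a strict monoidal category (X ⊗ Y) ⊗ Z and X ⊗ (Y ⊗ Z) are equal, but in
   general not convertible, objects. An equality e : X = Y is turned into the
   morphism [eqm e : hom X Y], which is the identity of X transported along e.
   All the structural morphisms below (assoc, lunit, runit and their inverses)
   are such identities; they are left implicit in the usual strict notation. *)
Definition eqm (k : comPzRingType) (C : linear_category k) (X Y : C)
  (e : X = Y) : hom X Y := ecast Z (hom X Z) e (idm X).

Record strict_monoidal (k : comPzRingType) := StrictMonoidal {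
  base :> linear_category k;
  tunit : base;
  tens : base -> base -> base;
  tensA : forall X Y Z, tens (tens X Y) Z = tens X (tens Y Z);
  tens1o : forall X, tens tunit X = X;
  tenso1 : forall X, tens X tunit = X;
  tensm : forall X X' Y Y', hom X X' -> hom Y Y' -> hom (tens X Y) (tens X' Y');
  tensm_id : forall X Y, tensm (idm X) (idm Y) = idm (tens X Y);
  tensm_comp : forall X X' X'' Y Y' Y'' (f' : hom X' X'') (f : hom X X')
      (g' : hom Y' Y'') (g : hom Y Y'),
    tensm (f' ∘ f) (g' ∘ g) = tensm f' g' ∘ tensm f g;
  tensm_linearr : forall X X' Y Y' (f : hom X X'), linear (@tensm X X' Y Y' f);
  tensm_linearl : forall X X' Y Y' (g : hom Y Y'),
    linear (fun f : hom X X' => tensm f g);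
  (* These three laws read (f ⊗ g) ⊗ h = f ⊗ (g ⊗ h), id_1 ⊗ f = f and
     f ⊗ id_1 = f when the identities eqm are left implicit. *)
  tensmA : forall X X' Y Y' Z Z' (f : hom X X') (g : hom Y Y') (h : hom Z Z'),
    eqm (tensA X' Y' Z') ∘ tensm (tensm f g) h
    = tensm f (tensm g h) ∘ eqm (tensA X Y Z);
  tensm1m : forall X Y (f : hom X Y),
    eqm (tens1o Y) ∘ tensm (idm tunit) f = f ∘ eqm (tens1o X);
  tensmm1 : forall X Y (f : hom X Y),
    eqm (tenso1 Y) ∘ tensm f (idm tunit) = f ∘ eqm (tenso1 X)
}.
Arguments tunit {k s}.
Arguments tens {k s} X Y.

Notation "X ⊗ Y" := (tens X Y) (at level 39, left associativity) : cat_scope.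
Notation "f ⊠ g" := (tensm f g) (at level 39, left associativity) : cat_scope.

Section Structural.
Variables (k : comPzRingType) (C : strict_monoidal k).
Implicit Types X Y Z : C.

Definition assoc X Y Z : hom (X ⊗ Y ⊗ Z) (X ⊗ (Y ⊗ Z)) := eqm (tensA X Y Z).
Definition assocV X Y Z : hom (X ⊗ (Y ⊗ Z)) (X ⊗ Y ⊗ Z) :=
  eqm (esym (tensA X Y Z)).
Definition lunit X : hom (tunit ⊗ X) X := eqm (tens1o X).
Definition lunitV X : hom X (tunit ⊗ X) := eqm (esym (tens1o X)).
Definition runit X : hom (X ⊗ tunit) X := eqm (tenso1 X).
Definition runitV X : hom X (X ⊗ tunit) := eqm (esym (tenso1 X)).

End Structural.

(** * Morphisms that agree up to equality of their sources and targets *)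

Section SameMorphism.
Variables (k : comPzRingType) (C : strict_monoidal k).
Implicit Types A B D E X Y Z W : C.

(* When X = X' and Y = Y', f and g are equal after transport. *)
Definition heq X Y X' Y' (f : hom X Y) (g : hom X' Y') : Prop :=
  exists (eX : X = X') (eY : Y = Y'), g ∘ eqm eX = eqm eY ∘ f.

Local Infix "~~" := heq (at level 70).

Lemma eqm1 X (e : X = X) : eqm e = idm X.
Proof. by rewrite (Prop_irrelevance e erefl). Qed.

Lemma heq_eq X Y (f g : hom X Y) : f ~~ g -> f = g.
Proof. by move=> [eX [eY]]; rewrite !eqm1 comp1m compm1. Qed.

Lemma heq_refl X Y (f : hom X Y) : f ~~ f.
Proof. by exists erefl, erefl; rewrite /eqm /= comp1m compm1. Qed.

Lemma heq_sym X Y X' Y' (f : hom X Y) (g : hom X' Y') : f ~~ g -> g ~~ f.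
Proof.
move=> [eX [eY]]; subst; rewrite /eqm /= comp1m compm1 => ->.
exact: heq_refl.
Qed.

Lemma heq_trans X Y X' Y' X'' Y'' (f : hom X Y) (g : hom X' Y') (h : hom X'' Y''):
  f ~~ g -> g ~~ h -> f ~~ h.
Proof. by move=> [eX [eY]]; subst; rewrite /eqm /= comp1m compm1 => ->. Qed.

Lemma heq_comp X Y Z X' Y' Z' (f : hom X Y) (g : hom Y Z)
    (f' : hom X' Y') (g' : hom Y' Z') :
  g ~~ g' -> f ~~ f' -> g ∘ f ~~ g' ∘ f'.
Proof.
move=> [e1 [e2]]; subst; rewrite /eqm /= comp1m compm1 => <- [e1 [e2]]; subst.
rewrite !eqm1 comp1m compm1 => <-; exact: heq_refl.
Qed.

Lemma heq_tens X Y Z W X' Y' Z' W' (f : hom X Y) (g : hom Z W)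
    (f' : hom X' Y') (g' : hom Z' W') :
  f ~~ f' -> g ~~ g' -> f ⊠ g ~~ f' ⊠ g'.
Proof.
move=> [e1 [e2]]; subst; rewrite /eqm /= comp1m compm1 => <- [e1 [e2]]; subst.
rewrite /eqm /= comp1m compm1 => <-; exact: heq_refl.
Qed.

Lemma heq_eqml X Y Z (e : Y = Z) (f : hom X Y) : eqm e ∘ f ~~ f.
Proof. by subst; rewrite eqm1 comp1m; exact: heq_refl. Qed.

Lemma heq_eqmr X Y Z (e : Z = X) (f : hom X Y) : f ∘ eqm e ~~ f.
Proof. by subst; rewrite eqm1 compm1; exact: heq_refl. Qed.

Lemma heq_id X Y : X = Y -> idm X ~~ idm Y.
Proof. by move->; exact: heq_refl. Qed.

Lemma heq_A X X' Y Y' Z Z' (f : hom X X') (g : hom Y Y') (h : hom Z Z') :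
  (f ⊠ g) ⊠ h ~~ f ⊠ (g ⊠ h).
Proof. by exists (tensA X Y Z), (tensA X' Y' Z'); rewrite tensmA. Qed.

Lemma heq_1m X Y (f : hom X Y) : idm tunit ⊠ f ~~ f.
Proof. by exists (tens1o X), (tens1o Y); rewrite tensm1m. Qed.

Lemma heq_m1 X Y (f : hom X Y) : f ⊠ idm tunit ~~ f.
Proof. by exists (tenso1 X), (tenso1 Y); rewrite tensmm1. Qed.

Definition isid X Y (h : hom X Y) := h ~~ idm X.

Lemma isid_eqm X Y (e : X = Y) : isid (eqm e).
Proof. by subst; rewrite eqm1; exact: heq_refl. Qed.

Lemma isid_tensr X Y Z (h : hom X Y) : isid h -> isid (h ⊠ idm Z).
Proof. by rewrite /isid -tensm_id => hh; apply: heq_tens => //; exact: heq_refl. Qed.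

Lemma isid_tensl X Y Z (h : hom X Y) : isid h -> isid (idm Z ⊠ h).
Proof. by rewrite /isid -tensm_id => hh; apply: heq_tens => //; exact: heq_refl. Qed.

Lemma dropl X Y Z X' Y' (h : hom Y Z) (f : hom X Y) (f' : hom X' Y') :
  isid h -> f ~~ f' -> h ∘ f ~~ f'.
Proof.
move=> [eY [eZ]]; subst; rewrite !eqm1 compm1 comp1m => <-.
by rewrite comp1m.
Qed.

Lemma dropr X Y Z X' Y' (h : hom X Y) (f : hom Y Z) (f' : hom X' Y') :
  isid h -> f ~~ f' -> f ∘ h ~~ f'.
Proof.
move=> [eY [eZ]]; subst; rewrite !eqm1 compm1 comp1m => <-.
by rewrite compm1.
Qed.

Definition lsn A B D (e : hom (A ⊗ B) tunit) (d : hom tunit (B ⊗ D)) :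
    hom A D :=
  lunit D ∘ (e ⊠ idm D) ∘ assocV A B D ∘ (idm A ⊠ d) ∘ runitV A.

Lemma ichl A B X Y (f : hom A B) (g : hom X Y) :
  (f ⊠ idm Y) ∘ (idm A ⊠ g) = f ⊠ g.
Proof. by rewrite -tensm_comp comp1m compm1. Qed.

Lemma ichr A B X Y (f : hom A B) (g : hom X Y) :
  (idm B ⊠ g) ∘ (f ⊠ idm X) = f ⊠ g.
Proof. by rewrite -tensm_comp comp1m compm1. Qed.

Lemma tens1_comp A X Y Z (g : hom Y Z) (f : hom X Y) :
  idm A ⊠ (g ∘ f) = (idm A ⊠ g) ∘ (idm A ⊠ f).
Proof. by rewrite -tensm_comp comp1m. Qed.

Lemma tensm1_comp A X Y Z (g : hom Y Z) (f : hom X Y) :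
  (g ∘ f) ⊠ idm A = (g ⊠ idm A) ∘ (f ⊠ idm A).
Proof. by rewrite -tensm_comp comp1m. Qed.

Lemma lsn_comp A B D E (a : hom (A ⊗ B) tunit) (c : hom tunit (B ⊗ D))
   (e : hom (D ⊗ B) tunit) (d : hom tunit (B ⊗ E)) :
  runit B ∘ (idm B ⊠ e) ∘ assoc B D B ∘ (c ⊠ idm B) ∘ lunitV B = idm B ->
  lsn e d ∘ lsn a c = lsn a d.
Proof.
move=> snk.
have nat (h : hom A D) : lsn e d ∘ h = lsn (e ∘ (h ⊠ idm B)) d.
  have hA : h ⊠ idm B ⊠ idm E ~~ h ⊠ idm (B ⊗ E) by rewrite -tensm_id; exact: heq_A.
  have hR : runitV D ∘ h = (h ⊠ idm tunit) ∘ runitV A.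
    apply: heq_eq; apply: (heq_trans (heq_eqml _ _)); apply: heq_sym.
    by apply: (heq_trans (heq_eqmr _ _)); apply: heq_m1.
  have hV : assocV D B E ∘ (h ⊠ idm (B ⊗ E)) = (h ⊠ idm B ⊠ idm E) ∘ assocV A B E.
    apply: heq_eq; apply: (heq_trans (heq_eqml _ _)); apply: heq_sym.
    by apply: (heq_trans (heq_eqmr _ _)); apply: hA.
  rewrite /lsn -!compA hR tensm1_comp -!compA; congr (_ ∘ (_ ∘ _)).
  by rewrite (compA (idm D ⊠ d)) ichr -ichl compA compA hV -!compA.
rewrite nat; congr lsn; apply: heq_eq.
rewrite /lsn !tensm1_comp !compA.
have s1 : (e ∘ (lunit D ⊠ idm B)) ∘ (a ⊠ idm D ⊠ idm B) ~~
    a ∘ (idm A ⊠ (runit B ∘ (idm B ⊠ e))).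
  apply: (@heq_trans _ _ _ _ _ _ _ (a ⊠ e)).
    rewrite -(ichr a e); apply: heq_comp.
      by apply: dropr; [exact/isid_tensr/isid_eqm|exact/heq_sym/heq_1m].
    by rewrite -tensm_id; exact: heq_A.
  rewrite -ichl; apply: heq_comp; first exact: heq_m1.
  rewrite -tensm_id; apply: (heq_trans (heq_A _ _ _)).
  apply: heq_tens; first exact: heq_refl.
  by apply: heq_sym; apply: dropl; [exact: isid_eqm|exact: heq_refl].
have s2 : (assocV A B D ⊠ idm B) ∘ (idm A ⊠ c ⊠ idm B) ∘ (runitV A ⊠ idm B) ~~
   idm A ⊠ (assoc B D B ∘ (c ⊠ idm B) ∘ lunitV B).
  apply: dropl; first exact/isid_tensr/isid_eqm.
  apply: dropr; first exact/isid_tensr/isid_eqm.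
  apply: (heq_trans (heq_A _ _ _)); apply: heq_tens; first exact: heq_refl.
  apply: heq_sym; apply: dropl; first exact: isid_eqm.
  by apply: dropr; [exact: isid_eqm|exact: heq_refl].
have := heq_comp s1 s2; rewrite -!compA -!tens1_comp -!compA snk tensm_id compm1.
exact.
Qed.
End SameMorphism.

(** * Pivotal k-categories *)

Record duality_data (k : comPzRingType) (C : strict_monoidal k) := DualityData {
  dual : C -> C;
  ev : forall X, hom (dual X ⊗ X) tunit;
  coev : forall X, hom tunit (X ⊗ dual X);
  evt : forall X, hom (X ⊗ dual X) tunit;
  coevt : forall X, hom tunit (dual X ⊗ X)
}.

Section Duality.
Variables (k : comPzRingType) (C : strict_monoidal k) (D : duality_data C).
Implicit Types X Y : C.
Local Notation "X ^∨" := (dual D X) (at level 2, format "X ^∨") : cat_scope.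

Definition left_duality : Prop := forall X,
  runit X ∘ (idm X ⊠ ev D X) ∘ assoc X X^∨ X ∘ (coev D X ⊠ idm X) ∘ lunitV X
    = idm X /\
  lunit X^∨ ∘ (ev D X ⊠ idm X^∨) ∘ assocV X^∨ X X^∨
    ∘ (idm X^∨ ⊠ coev D X) ∘ runitV X^∨ = idm X^∨.

Definition right_duality : Prop := forall X,
  lunit X ∘ (evt D X ⊠ idm X) ∘ assocV X X^∨ X ∘ (idm X ⊠ coevt D X)
    ∘ runitV X = idm X /\
  runit X^∨ ∘ (idm X^∨ ⊠ evt D X) ∘ assoc X^∨ X X^∨
    ∘ (coevt D X ⊠ idm X^∨) ∘ lunitV X^∨ = idm X^∨.

Definition left_dual X Y (f : hom X Y) : hom Y^∨ X^∨ :=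
  lunit X^∨ ∘ (ev D Y ⊠ idm X^∨) ∘ (idm Y^∨ ⊠ f ⊠ idm X^∨)
    ∘ assocV Y^∨ X X^∨ ∘ (idm Y^∨ ⊠ coev D X) ∘ runitV Y^∨.

Definition right_dual X Y (f : hom X Y) : hom Y^∨ X^∨ :=
  runit X^∨ ∘ (idm X^∨ ⊠ evt D Y) ∘ (idm X^∨ ⊠ (f ⊠ idm Y^∨))
    ∘ assoc X^∨ X Y^∨ ∘ (coevt D X ⊠ idm Y^∨) ∘ lunitV Y^∨.

(* Nested evaluations, the inner one being that of Y, resp. of X. *)
Definition ev2 X Y : hom (X^∨ ⊗ Y^∨ ⊗ (Y ⊗ X)) tunit :=
  ev D X ∘ (idm X^∨ ⊠ (lunit X ∘ (ev D Y ⊠ idm X) ∘ assocV Y^∨ Y X))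
    ∘ assoc X^∨ Y^∨ (Y ⊗ X).

Definition evt2 X Y : hom (Y ⊗ X ⊗ (X^∨ ⊗ Y^∨)) tunit :=
  evt D Y ∘ (idm Y ⊠ (lunit Y^∨ ∘ (evt D X ⊠ idm Y^∨)
    ∘ assocV X X^∨ Y^∨)) ∘ assoc Y X (X^∨ ⊗ Y^∨).

(* The monoidal constraints X^∨ ⊗ Y^∨ -> (Y ⊗ X)^∨ of the left and right dual
   functors; their constraints 1 -> 1^∨ are coev_1 and coevt_1. *)
Definition left_dual2 X Y : hom (X^∨ ⊗ Y^∨) (Y ⊗ X)^∨ :=
  lunit (Y ⊗ X)^∨ ∘ (ev2 X Y ⊠ idm (Y ⊗ X)^∨)
    ∘ assocV (X^∨ ⊗ Y^∨) (Y ⊗ X) (Y ⊗ X)^∨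
    ∘ (idm (X^∨ ⊗ Y^∨) ⊠ coev D (Y ⊗ X)) ∘ runitV (X^∨ ⊗ Y^∨).

Definition right_dual2 X Y : hom (X^∨ ⊗ Y^∨) (Y ⊗ X)^∨ :=
  runit (Y ⊗ X)^∨ ∘ (idm (Y ⊗ X)^∨ ⊠ evt2 X Y)
    ∘ assoc (Y ⊗ X)^∨ (Y ⊗ X) (X^∨ ⊗ Y^∨)
    ∘ (coevt D (Y ⊗ X) ⊠ idm (X^∨ ⊗ Y^∨)) ∘ lunitV (X^∨ ⊗ Y^∨).

Definition left_dual0 : hom tunit tunit^∨ := lunit tunit^∨ ∘ coev D tunit.

Definition right_dual0 : hom tunit tunit^∨ := runit tunit^∨ ∘ coevt D tunit.

End Duality.

Record pivotal_category (k : comPzRingType) := PivotalCategory {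
  pbase :> strict_monoidal k;
  pdata : duality_data pbase;
  leftP : left_duality pdata;
  rightP : right_duality pdata;
  dual_mor : forall (X Y : pbase) (f : hom X Y),
    left_dual pdata f = right_dual pdata f;
  dual_mor2 : forall X Y : pbase, left_dual2 pdata X Y = right_dual2 pdata X Y;
  dual_mor0 : left_dual0 pdata = right_dual0 pdata;
  (* b is a basis of the k-module End(1) *)
  end_unit_free1 : exists b : End (@tunit k pbase),
    bijective (fun c : k => c *: b)
}.

Section Pivotal.
Variables (k : comPzRingType) (C : pivotal_category k).
Implicit Types X Y Z U V W : C.

Definition pdual X : C := dual (pdata C) X.
Local Notation "X ^∨" := (pdual X) (at level 2, format "X ^∨") : cat_scope.
Definition pev X : hom (X^∨ ⊗ X) tunit := ev (pdata C) X.
Definition pcoev X : hom tunit (X ⊗ X^∨) := coev (pdata C) X.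
Definition pevt X : hom (X ⊗ X^∨) tunit := evt (pdata C) X.
Definition pcoevt X : hom tunit (X^∨ ⊗ X) := coevt (pdata C) X.

Definition dualm X Y (f : hom X Y) : hom Y^∨ X^∨ := left_dual (pdata C) f.

(* The pivotal structure and its inverse (see phiK and phiVK). *)
Definition phi X : hom X X^∨^∨ :=
  lunit X^∨^∨ ∘ (pevt X ⊠ idm X^∨^∨) ∘ assocV X X^∨ X^∨^∨
    ∘ (idm X ⊠ pcoev X^∨) ∘ runitV X.

Definition phiV X : hom X^∨^∨ X :=
  lunit X ∘ (pev X^∨ ⊠ idm X) ∘ assocV X^∨^∨ X^∨ X
    ∘ (idm X^∨^∨ ⊠ pcoevt X) ∘ runitV X^∨^∨.

Lemma phiK X : phiV X ∘ phi X = idm X.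
Proof.
rewrite (_ : phiV X = lsn (pev X^∨) (pcoevt X)) //.
rewrite (_ : phi X = lsn (pevt X) (pcoev X^∨)) //.
rewrite lsn_comp; first exact: (rightP X).1.
exact: (leftP X^∨).1.
Qed.

Lemma phiVK X : phi X ∘ phiV X = idm X^∨^∨.
Proof.
rewrite (_ : phiV X = lsn (pev X^∨) (pcoevt X)) //.
rewrite (_ : phi X = lsn (pevt X) (pcoev X^∨)) //.
rewrite lsn_comp; first exact: (leftP X^∨).2.
exact: (rightP X).2.
Qed.

Definition trl X Y Z (f : hom (X ⊗ Y) (X ⊗ Z)) : hom Y Z :=
  lunit Z ∘ (pev X ⊠ idm Z) ∘ assocV X^∨ X Z ∘ (idm X^∨ ⊠ f)
    ∘ assoc X^∨ X Y ∘ (pcoevt X ⊠ idm Y) ∘ lunitV Y.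

Definition trr X Y Z (g : hom (Y ⊗ X) (Z ⊗ X)) : hom Y Z :=
  runit Z ∘ (idm Z ⊠ pevt X) ∘ assoc Z X X^∨ ∘ (g ⊠ idm X^∨)
    ∘ assocV Y X X^∨ ∘ (idm Y ⊠ pcoev X) ∘ runitV Y.

(** * Ideals and traces *)

Definition retract U X : Prop :=
  exists (p : hom X U) (q : hom U X), p ∘ q = idm U.

Record ideal := Ideal {
  ideal_mem :> C -> Prop;
  ideal_retract : forall U X, retract U X -> ideal_mem X -> ideal_mem U;
  ideal_tensl : forall Y X, ideal_mem X -> ideal_mem (Y ⊗ X);
  ideal_tensr : forall Y X, ideal_mem X -> ideal_mem (X ⊗ Y)
}.

(* Families indexed by the objects of the class O; the membership proof carries
   no information since O X is a proposition. *)
Definition linear_forms (O : C -> Prop) := forall X, O X -> {scalar End X}.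

Definition is_trace (I : ideal) (t : linear_forms I) : Prop :=
  [/\ forall U V (hU : I U) (hV : I V) (g : hom U V) (h : hom V U),
        t V hV (g ∘ h) = t U hU (h ∘ g),
      forall X Y (hX : I X) (f : End (Y ⊗ X)),
        t (Y ⊗ X) (ideal_tensl Y hX) f = t X hX (trl f)
    & forall X Y (hX : I X) (f : End (X ⊗ Y)),
        t (X ⊗ Y) (ideal_tensr Y hX) f = t X hX (trr f)].

(* Membership in I_O; the ideal itself is gen_ideal O. *)
Definition gen_mem (O : C -> Prop) (U : C) : Prop :=
  exists Y X Z, O X /\ retract U (Y ⊗ X ⊗ Z).

Lemma retract_trans U V W : retract U V -> retract V W -> retract U W.
Proof.
move=> [p [q pq]] [p' [q' pq']]; exists (p ∘ p'), (q' ∘ q).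
by rewrite -compA (compA p') pq' comp1m.
Qed.

Lemma retract_eq X Y : X = Y -> retract X Y.
Proof. by move=> ->; exists (idm Y), (idm Y); rewrite comp1m. Qed.

Lemma retract_tensl Y U X : retract U X -> retract (Y ⊗ U) (Y ⊗ X).
Proof.
move=> [p [q pq]]; exists (idm Y ⊠ p), (idm Y ⊠ q).
by rewrite -tensm_comp comp1m pq tensm_id.
Qed.

Lemma retract_tensr Y U X : retract U X -> retract (U ⊗ Y) (X ⊗ Y).
Proof.
move=> [p [q pq]]; exists (p ⊠ idm Y), (q ⊠ idm Y).
by rewrite -tensm_comp comp1m pq tensm_id.
Qed.

Lemma gen_retract O U X : retract U X -> gen_mem O X -> gen_mem O U.
Proof.
move=> rUX [A [B [D [OB r]]]]; exists A, B, D; split=> //.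
exact: retract_trans rUX r.
Qed.

Lemma gen_tensl O Y X : gen_mem O X -> gen_mem O (Y ⊗ X).
Proof.
move=> [A [B [D [OB r]]]]; exists (Y ⊗ A), B, D; split=> //.
apply: retract_trans (retract_tensl Y r) _; apply: retract_eq.
by rewrite !tensA.
Qed.

Lemma gen_tensr O Y X : gen_mem O X -> gen_mem O (X ⊗ Y).
Proof.
move=> [A [B [D [OB r]]]]; exists A, B, (D ⊗ Y); split=> //.
apply: retract_trans (retract_tensr Y r) _; apply: retract_eq.
by rewrite !tensA.
Qed.

Definition gen_ideal (O : C -> Prop) : ideal :=
  Ideal (@gen_retract O) (@gen_tensl O) (@gen_tensr O).

Lemma gen_ideal_sub (O : C -> Prop) X : O X -> gen_ideal O X.
Proof.
move=> OX; exists tunit, X, tunit; split=> //; apply: retract_eq.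
by rewrite tens1o tenso1.
Qed.

(* f is an endomorphism of X' ⊗ Y ⊗ X^∨, bracketed to the left; for the right
   partial trace it is regarded as an endomorphism of X' ⊗ (Y ⊗ X^∨). *)
Definition is_spherical_trace (O : C -> Prop) (t : linear_forms O) : Prop :=
  forall X X' (hX : O X) (hX' : O X') Y (f : End (X' ⊗ Y ⊗ X^∨)),
    t X hX (phiV X ∘ dualm (trl f) ∘ phi X)
    = t X' hX' (trr (assoc X' Y X^∨ ∘ f ∘ assocV X' Y X^∨)).

End Pivotal.

(* Main.v *)
From HB Require Import structures.
From mathcomp Require Import all_boot all_algebra boolp.
Require Import Defs.

Set Implicit Arguments.
Unset Strict Implicit.
Unset Printing Implicit Defensive.
Import GRing.Theory.
Local Open Scope ring_scope.
Local Open Scope cat_scope.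

(** Every object U of the ideal is a retract of some Y ⊗ X ⊗ Z with X in O, say
    p ∘ q = id_U with p : Y ⊗ X ⊗ Z -> U.  Cyclicity and the two partial trace
    properties force
      tt_U f = t_X (tr_l^Y (tr_r^Z (q ∘ f ∘ p))),
    whence uniqueness.  For existence this formula has to be independent of
    (Y, X, Z, p, q) and cyclic, and both follow from one identity,
    [spherical_swap]: for a : Y ⊗ X ⊗ Z -> Y' ⊗ X' ⊗ Z' and b in the opposite
    direction,
      t_X (tr_l^Y tr_r^Z (b ∘ a)) = t_X' (tr_l^Y' tr_r^Z' (a ∘ b)).

    On the sphere, both sides are the same planar graph: two coupons a and b
    joined by the strands Y, X, Z and Y', X', Z'.  The two sides differ by which
    strand, X or X', has been cut open.  A spherical trace allows exactly this
    change when the graph is presented as an endomorphism of X' ⊗ W ⊗ X^∨.  So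
    bend the Z strand to the right of a and b and the Y' strand to their left:
    with V = Y'^∨ ⊗ Y and W = Z' ⊗ Z^∨ it remains to treat a : V ⊗ X -> X' ⊗ W
    and b : X' ⊗ W -> V ⊗ X ([spherical_swap_one_sided]).  There
      f = (a ⊗ X^∨) (V ⊗ coev_X evt_X) (b ⊗ X^∨)
    is the required endomorphism: closing its strands W and X^∨ to the right
    gives tr_r^W (a ∘ b), and closing X' and W to the left gives the dual of
    tr_l^V (b ∘ a), which phi carries back since phi is natural.

    The categorical input is that partial traces are natural, commute with each
    other, are compatible with ⊗ and 1 ([trL_tens], [trL_unit] and their mirror
    images), are cyclic ([trL_cyc]), and that a strand bent back and forth
    through X^∨ can be straightened ([trR_bubble], [trL_bubble]).  The last
    point rests on [Evt_Phi], where the equality of the left and right duality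
    functors as monoidal functors enters in full.

    The computations are carried out with morphisms whose source and target are
    not part of the type; for these the monoidal structure is associative and
    unital on the nose, as equations between elements of one type. *)

(** * Morphisms with unspecified source and target *)

(** Equality in this type is equality of morphisms up to transport along
    equalities of their sources and targets, so that (f ⊗ g) ⊗ h and
    f ⊗ (g ⊗ h) become equal and can be rewritten into each other. *)
Record mor (k : comPzRingType) (C : linear_category k) :=
  Mor { dom : C; cod : C; arr : hom dom cod }.
Arguments Mor {k C dom cod} arr.

(* The composability conditions of the calculus below are equations between
   objects that hold by strictness of ⊗. *)
Ltac objeq :=
  simpl;
  repeat match goal with
  | H : dom ?f = _ |- context [dom ?f] => rewrite H
  | H : cod ?f = _ |- context [cod ?f] => rewrite H
  end;
  solve [rewrite ?(tensA, tens1o, tenso1); congruence].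
#[local] Hint Extern 0 (@eq (obj _) _ _) => objeq : core.

Section Mor.
Variables (k : comPzRingType) (C : strict_monoidal k).
Implicit Types (X Y Z : C) (f g h : mor C).

(** Non-composable morphisms get the composite 0, between the expected source
    and target.  As 0 is absorbing, associativity then holds without any
    composability condition. *)
Definition mcomp g f : mor C :=
  Mor (if pselect (cod f = dom g) is left e then arr g ∘ eqm e ∘ arr f else 0).
Definition mtens f g : mor C := Mor (arr f ⊠ arr g).
Definition mid X : mor C := Mor (idm X).

Lemma comp0m X Y Z (f : hom X Y) : (0 : hom Y Z) ∘ f = 0.
Proof.
have := comp_linearl f (-1) 0 (0 : hom Y Z).
by rewrite /= scaler0 add0r scaleN1r addNr.
Qed.

Lemma compm0 X Y Z (f : hom Y Z) : f ∘ (0 : hom X Y) = 0.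
Proof.
have := comp_linearr f (-1) 0 (0 : hom X Y).
by rewrite /= scaler0 add0r scaleN1r addNr.
Qed.

Lemma Mor_heq X Y X' Y' (f : hom X Y) (f' : hom X' Y') :
  heq f f' -> Mor f = Mor f' :> mor C.
Proof. by case=> eX [eY]; subst; rewrite !eqm1 comp1m compm1 => ->. Qed.

Lemma Mor_inj X Y (f g : hom X Y) : Mor f = Mor g :> mor C -> f = g.
Proof.
move=> fg; apply: heq_eq.
have arrE (m m' : mor C) : m = m' -> heq (arr m) (arr m').
  by move=> ->; exact: heq_refl.
exact: arrE fg.
Qed.

Lemma mor_typed (m : mor C) X Y :
  dom m = X -> cod m = Y -> exists f : hom X Y, Mor f = m.
Proof. by case: m => A B f /= <- <-; exists f. Qed.

Lemma Mor_comp X Y Z (g : hom Y Z) (f : hom X Y) :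
  Mor (g ∘ f) = mcomp (Mor g) (Mor f).
Proof. by rewrite /mcomp /=; case: pselect => // e; rewrite eqm1 comp1m. Qed.

Lemma Mor_eqml X Y Z (e : Y = Z) (f : hom X Y) : Mor (eqm e ∘ f) = Mor f.
Proof. by apply: Mor_heq; apply: heq_eqml. Qed.

Lemma Mor_eqmr X Y Z (e : Z = X) (f : hom X Y) : Mor (f ∘ eqm e) = Mor f.
Proof. by apply: Mor_heq; apply: heq_eqmr. Qed.

Lemma mcompA f g h : mcomp h (mcomp g f) = mcomp (mcomp h g) f.
Proof.
rewrite /mcomp /=.
case: (pselect (cod g = dom h)) => e1; case: (pselect (cod f = dom g)) => e2;
  by rewrite ?compm0 ?comp0m ?compA.
Qed.

Lemma mcompm1 f X : dom f = X -> mcomp f (mid X) = f.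
Proof. by case: f => A B f /= <-; rewrite -Mor_comp compm1. Qed.

Lemma mcomp1m f X : cod f = X -> mcomp (mid X) f = f.
Proof. by case: f => A B f /= <-; rewrite -Mor_comp comp1m. Qed.

Lemma mtensA f g h : mtens f (mtens g h) = mtens (mtens f g) h.
Proof. by apply: Mor_heq; apply: heq_sym; apply: heq_A. Qed.

Lemma mtens1m f : mtens (mid tunit) f = f.
Proof. by case: f => X Y f; apply: Mor_heq; apply: heq_1m. Qed.

Lemma mtensm1 f : mtens f (mid tunit) = f.
Proof. by case: f => X Y f; apply: Mor_heq; apply: heq_m1. Qed.

Lemma mid_tens X Y : mid (X ⊗ Y) = mtens (mid X) (mid Y).
Proof. by rewrite /mid -tensm_id. Qed.

(** Here composability cannot be dropped: the composites on the right may exist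
    although those on the left do not. *)
Lemma mtens_comp f f' g g' : cod f = dom f' -> cod g = dom g' ->
  mtens (mcomp f' f) (mcomp g' g) = mcomp (mtens f' g') (mtens f g).
Proof.
case: f f' g g' => A B f [A' B' f'] [D E g] [D' E' g'] /= e1 e2; subst.
by rewrite -!Mor_comp /mtens /= tensm_comp.
Qed.

End Mor.

Notation "g ∙ f" := (mcomp g f) (at level 41, right associativity) : cat_scope.
Notation "f ⊙ g" := (mtens f g) (at level 39, left associativity) : cat_scope.
Notation "‹ X ›" := (mid X) (format "‹ X ›") : cat_scope.
Notation "⌜ f ⌝" := (Mor f) (format "⌜ f ⌝") : cat_scope.

Section Interchange.
Variables (k : comPzRingType) (C : strict_monoidal k).
Implicit Types (X Y A B : C) (f g b c e n : mor C).

Lemma whiskerl A g f : cod f = dom g ->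
  ‹A› ⊙ (g ∙ f) = (‹A› ⊙ g) ∙ (‹A› ⊙ f).
Proof. by move=> e; rewrite -mtens_comp // mcompm1. Qed.

Lemma whiskerr A g f : cod f = dom g ->
  (g ∙ f) ⊙ ‹A› = (g ⊙ ‹A›) ∙ (f ⊙ ‹A›).
Proof. by move=> e; rewrite -mtens_comp // mcompm1. Qed.

Lemma interchange f g A B X Y :
    dom f = A -> cod f = B -> dom g = X -> cod g = Y ->
  (f ⊙ ‹Y›) ∙ (‹A› ⊙ g) = (‹B› ⊙ g) ∙ (f ⊙ ‹X›).
Proof. by move=> *; rewrite -!mtens_comp // !mcompm1 // !mcomp1m. Qed.

Lemma interchange_caps e b : cod e = tunit -> cod b = tunit ->
  e ∙ (b ⊙ ‹dom e›) = b ∙ (‹dom b› ⊙ e).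
Proof.
move=> he hb; rewrite -[X in X ∙ _]mtens1m.
by rewrite -(interchange (A := dom b) (X := dom e) (Y := tunit)) // mtensm1.
Qed.

Lemma interchange_cups n c : dom n = tunit -> dom c = tunit ->
  (‹cod c› ⊙ n) ∙ c = (c ⊙ ‹cod n›) ∙ n.
Proof.
move=> hn hc; rewrite -[X in _ = _ ∙ X]mtens1m.
by rewrite (interchange (B := cod c) (Y := cod n) (X := tunit)) // mtensm1.
Qed.

Lemma interchange_cup_cap e n : cod e = tunit -> dom n = tunit ->
  (‹cod n› ⊙ e) ∙ (n ⊙ ‹dom e›) = n ∙ e.
Proof.
move=> he hn; rewrite -(interchange (f := n) (A := tunit) (Y := tunit)) //.
by rewrite mtensm1 mtens1m.
Qed.

Lemma interchange_cap_cup e n : cod e = tunit -> dom n = tunit ->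
  (e ⊙ ‹cod n›) ∙ (‹dom e› ⊙ n) = n ∙ e.
Proof.
move=> he hn; rewrite (interchange (f := e) (B := tunit) (X := tunit)) //.
by rewrite mtensm1 mtens1m.
Qed.

End Interchange.

(** * Dual pairs and mates *)

Section DualPairs.
Variables (k : comPzRingType) (C : strict_monoidal k).
Implicit Types (P Q A V : C) (b c e n : mor C).

(** Both dualities of a pivotal category are of this form: the left one with
    (P, Q) = (X^∨, X), the right one with (P, Q) = (X, X^∨). *)
Record dual_pair P Q e n : Prop := DualPair {
  cap_dom : dom e = P ⊗ Q; cap_cod : cod e = tunit;
  cup_dom : dom n = tunit; cup_cod : cod n = Q ⊗ P;
  snakeQ : (‹Q› ⊙ e) ∙ (n ⊙ ‹Q›) = ‹Q›;
  snakeP : (e ⊙ ‹P›) ∙ (‹P› ⊙ n) = ‹P› }.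

(** The nested cap and cup: in each snake the inner cap of one pair first slides
    past the outer cup of the other, leaving two separate snakes. *)
Lemma dual_pair_tens P Q e n P' Q' e' n' :
  dual_pair P Q e n -> dual_pair P' Q' e' n' ->
  dual_pair (P ⊗ P') (Q' ⊗ Q) (e ∙ (‹P› ⊙ (e' ⊙ ‹Q›)))
    ((‹Q'› ⊙ (n ⊙ ‹P'›)) ∙ n').
Proof.
move=> [e1 e2 n1 n2 sQ sP] [e1' e2' n1' n2' sQ' sP']; split=> //.
  have slide : (‹Q› ⊙ ‹P› ⊙ e') ∙ (n ⊙ ‹P'› ⊙ ‹Q'›) = n ∙ e'.
    by rewrite -(interchange_cup_cap (e := e')) // n2 e1' !mid_tens !mtensA.
  have -> : (‹Q' ⊗ Q› ⊙ (e ∙ (‹P› ⊙ (e' ⊙ ‹Q›))))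
        ∙ (((‹Q'› ⊙ (n ⊙ ‹P'›)) ∙ n') ⊙ ‹Q' ⊗ Q›)
      = (‹Q'› ⊙ ((‹Q› ⊙ e)
          ∙ (((‹Q› ⊙ ‹P› ⊙ e') ∙ (n ⊙ ‹P'› ⊙ ‹Q'›)) ⊙ ‹Q›)))
        ∙ (n' ⊙ ‹Q'› ⊙ ‹Q›).
    by rewrite !whiskerl // !whiskerr // !whiskerl // -!mcompA !mid_tens !mtensA.
  rewrite slide whiskerr // mcompA sQ mcomp1m // mtensA -whiskerr // sQ'.
  by rewrite mid_tens.
have slide : (e' ⊙ ‹Q› ⊙ ‹P›) ∙ (‹P'› ⊙ ‹Q'› ⊙ n) = n ∙ e'.
  by rewrite -(interchange_cap_cup (e := e')) // n2 e1' !mid_tens !mtensA.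
have -> : ((e ∙ (‹P› ⊙ (e' ⊙ ‹Q›))) ⊙ ‹P ⊗ P'›)
      ∙ (‹P ⊗ P'› ⊙ ((‹Q'› ⊙ (n ⊙ ‹P'›)) ∙ n'))
    = (e ⊙ ‹P› ⊙ ‹P'›)
      ∙ (‹P› ⊙ ((((e' ⊙ ‹Q› ⊙ ‹P›) ∙ (‹P'› ⊙ ‹Q'› ⊙ n)) ⊙ ‹P'›)
          ∙ (‹P'› ⊙ n'))).
  by rewrite !whiskerl // !whiskerr // !whiskerl // -!mcompA !mid_tens !mtensA.
rewrite slide whiskerr // -mcompA sP' mcompm1 // mtensA -whiskerr // sP.
by rewrite mid_tens.
Qed.

Variables (P Q : C) (e n : mor C) (d : dual_pair P Q e n).

(** The transposes of a form b on V ⊗ Q, resp. on P ⊗ V: morphisms V -> P, resp.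
    V -> Q, from which b is recovered by [lmate_ev], resp. [rmate_ev].  Dual
    morphisms, the monoidal constraints of the dual functors and the pivotal
    structure are all of this kind. *)
Definition lmate V b := (b ⊙ ‹P›) ∙ (‹V› ⊙ n).
Definition rmate V b := (‹Q› ⊙ b) ∙ (n ⊙ ‹V›).

Lemma lmate_ev V b : dom b = V ⊗ Q -> cod b = tunit ->
  e ∙ (lmate V b ⊙ ‹Q›) = b.
Proof.
case: d => e1 e2 n1 n2 s1 s2 b1 b2.
rewrite /lmate whiskerr // -mtensA -mid_tens -e1 mcompA interchange_caps //.
by rewrite b1 mid_tens -!mtensA -mcompA -whiskerl // s1 -mid_tens mcompm1.
Qed.

(** On a cup c, the mate of b acts through the operator Q -> A obtained by
    contracting c with b. *)
Lemma lmate_coev V b A c :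
    dom b = V ⊗ Q -> cod b = tunit -> dom c = tunit -> cod c = A ⊗ V ->
  (‹A› ⊙ lmate V b) ∙ c = (((‹A› ⊙ b) ∙ (c ⊙ ‹Q›)) ⊙ ‹P›) ∙ n.
Proof.
case: d => e1 e2 n1 n2 s1 s2 b1 b2 c1 c2.
rewrite /lmate whiskerl // -mcompA !mtensA -mid_tens -c2 interchange_cups //.
by rewrite n2 mid_tens !mtensA whiskerr // -mcompA.
Qed.

Lemma rmate_ev V b : dom b = P ⊗ V -> cod b = tunit ->
  e ∙ (‹P› ⊙ rmate V b) = b.
Proof.
case: d => e1 e2 n1 n2 s1 s2 b1 b2.
rewrite /rmate whiskerl // mtensA -mid_tens -e1 mcompA -interchange_caps //.
by rewrite b1 mid_tens !mtensA -mcompA -whiskerr // s2 -mid_tens mcompm1.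
Qed.

Lemma rmate_coev V b A c :
    dom b = P ⊗ V -> cod b = tunit -> dom c = tunit -> cod c = V ⊗ A ->
  (rmate V b ⊙ ‹A›) ∙ c = (‹Q› ⊙ ((b ⊙ ‹A›) ∙ (‹P› ⊙ c))) ∙ n.
Proof.
case: d => e1 e2 n1 n2 s1 s2 b1 b2 c1 c2.
rewrite /rmate whiskerr // -mcompA -!mtensA -mid_tens -c2 -interchange_cups //.
by rewrite n2 mid_tens -!mtensA whiskerl // -mcompA.
Qed.

End DualPairs.

Section Pivotal.
Variables (k : comPzRingType) (C : pivotal_category k).
Implicit Types (X Y Z A B V W : C).

Local Notation "X ^∨" := (pdual X) (at level 2, format "X ^∨") : cat_scope.

(** * Duality in a pivotal category *)

Definition Ev X := ⌜pev X⌝.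
Definition Co X := ⌜pcoev X⌝.
Definition Evt X := ⌜pevt X⌝.
Definition Cot X := ⌜pcoevt X⌝.

Lemma left_dual_pair X : dual_pair X^∨ X (Ev X) (Co X).
Proof.
have [/(congr1 Mor) s1 /(congr1 Mor) s2] := leftP (p := C) X; split=> //.
  by move: s1; rewrite Mor_eqml Mor_comp Mor_eqml Mor_eqmr.
by move: s2; rewrite Mor_eqml Mor_comp Mor_eqml Mor_eqmr.
Qed.

Lemma right_dual_pair X : dual_pair X X^∨ (Evt X) (Cot X).
Proof.
have [/(congr1 Mor) s1 /(congr1 Mor) s2] := rightP (p := C) X; split=> //.
  by move: s2; rewrite Mor_eqml Mor_comp Mor_eqml Mor_eqmr.
by move: s1; rewrite Mor_eqml Mor_comp Mor_eqml Mor_eqmr.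
Qed.

Lemma dualm_lmate X Y (f : hom X Y) :
  ⌜dualm f⌝ = lmate X^∨ (Co X) Y^∨ (Ev Y ∙ (‹Y^∨› ⊙ ⌜f⌝)).
Proof.
rewrite /dualm /left_dual Mor_eqml 2!Mor_comp Mor_eqml Mor_eqmr.
by rewrite /lmate whiskerr // -mcompA.
Qed.

Lemma dualm_rmate X Y (f : hom X Y) :
  ⌜dualm f⌝ = rmate X^∨ (Cot X) Y^∨ (Evt Y ∙ (⌜f⌝ ⊙ ‹Y^∨›)).
Proof.
rewrite /dualm dual_mor /right_dual Mor_eqml 2!Mor_comp Mor_eqml Mor_eqmr.
by rewrite /rmate whiskerl // -mcompA.
Qed.

Lemma dualm_Ev X Y (f : hom X Y) :
  Ev X ∙ (⌜dualm f⌝ ⊙ ‹X›) = Ev Y ∙ (‹Y^∨› ⊙ ⌜f⌝).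
Proof. by rewrite dualm_lmate (lmate_ev (left_dual_pair X)). Qed.

Lemma dualm_Evt X Y (f : hom X Y) :
  Evt X ∙ (‹X› ⊙ ⌜dualm f⌝) = Evt Y ∙ (⌜f⌝ ⊙ ‹Y^∨›).
Proof. by rewrite dualm_rmate (rmate_ev (right_dual_pair X)). Qed.

Lemma dualm_Co X Y (f : hom X Y) :
  (‹Y› ⊙ ⌜dualm f⌝) ∙ Co Y = (⌜f⌝ ⊙ ‹X^∨›) ∙ Co X.
Proof.
rewrite dualm_lmate (lmate_coev (left_dual_pair X)) // whiskerl // -mcompA.
rewrite mtensA -mid_tens.
rewrite -(interchange (f := Co Y) (A := tunit) (X := X) (Y := Y)) // mcompA.
by rewrite (snakeQ (left_dual_pair Y)) mtens1m mcomp1m.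
Qed.

Lemma dualm_Cot X Y (f : hom X Y) :
  (⌜dualm f⌝ ⊙ ‹Y›) ∙ Cot Y = (‹X^∨› ⊙ ⌜f⌝) ∙ Cot X.
Proof.
rewrite dualm_rmate (rmate_coev (right_dual_pair X)) // whiskerr // -mcompA.
rewrite -mtensA -mid_tens.
rewrite (interchange (g := Cot Y) (A := X) (X := tunit) (B := Y)) // mcompA.
by rewrite (snakeP (right_dual_pair Y)) mtensm1 mcomp1m.
Qed.

Definition Ev2 X Y := Ev X ∙ (‹X^∨› ⊙ (Ev Y ⊙ ‹X›)).
Definition Co2 X Y := (‹Y› ⊙ (Co X ⊙ ‹Y^∨›)) ∙ Co Y.
Definition Evt2 X Y := Evt Y ∙ (‹Y› ⊙ (Evt X ⊙ ‹Y^∨›)).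
Definition Cot2 X Y := (‹X^∨› ⊙ (Cot Y ⊙ ‹X›)) ∙ Cot X.
Definition dual2 X Y := ⌜left_dual2 (pdata C) X Y⌝.

Lemma dual2_lmate X Y :
  dual2 X Y = lmate (Y ⊗ X)^∨ (Co (Y ⊗ X)) (X^∨ ⊗ Y^∨) (Ev2 X Y).
Proof.
have -> : Ev2 X Y = ⌜ev2 (pdata C) X Y⌝.
  have inner : ⌜lunit X ∘ (pev Y ⊠ idm X) ∘ assocV Y^∨ Y X⌝ = Ev Y ⊙ ‹X›.
    by rewrite Mor_eqml Mor_eqmr.
  by rewrite /ev2 Mor_comp Mor_eqmr /Ev2 -inner.
by rewrite /dual2 /left_dual2 Mor_eqml Mor_comp Mor_eqml Mor_eqmr.
Qed.

Lemma dual2_rmate X Y :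
  dual2 X Y = rmate (Y ⊗ X)^∨ (Cot (Y ⊗ X)) (X^∨ ⊗ Y^∨) (Evt2 X Y).
Proof.
have -> : Evt2 X Y = ⌜evt2 (pdata C) X Y⌝.
  have inner :
      ⌜lunit Y^∨ ∘ (pevt X ⊠ idm Y^∨) ∘ assocV X X^∨ Y^∨⌝ = Evt X ⊙ ‹Y^∨›.
    by rewrite Mor_eqml Mor_eqmr.
  by rewrite /evt2 Mor_comp Mor_eqmr /Evt2 -inner.
by rewrite /dual2 dual_mor2 /right_dual2 Mor_eqml Mor_comp Mor_eqml Mor_eqmr.
Qed.

Lemma Co_unit : Co tunit = Cot tunit.
Proof.
by move/(congr1 Mor): (dual_mor0 C); rewrite /left_dual0 /right_dual0 !Mor_eqml.
Qed.

Lemma lmate_unit : lmate tunit^∨ (Co tunit) tunit ‹tunit› = Co tunit.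
Proof. by rewrite /lmate !mtens1m mcomp1m. Qed.

Lemma rmate_unit : rmate tunit^∨ (Cot tunit) tunit ‹tunit› = Co tunit.
Proof. by rewrite /rmate !mtensm1 mcomp1m // Co_unit. Qed.

(** * The pivotal structure *)

(** The dual of f : W -> 1, read as an element of W^∨ through 1 = 1^∨, computed
    with the left duality and with the right one. *)
Lemma flip_coev W (f : hom W tunit) :
  (⌜f⌝ ⊙ ‹W^∨›) ∙ Co W = (‹W^∨› ⊙ ⌜f⌝) ∙ Cot W.
Proof. by rewrite -dualm_Co -dualm_Cot mtens1m mtensm1 Co_unit. Qed.

(** An element of W^∨ represents the same form on W through both evaluations. *)
Lemma flip_ev W (x : hom tunit W^∨) (f : hom W tunit) :
  Ev W ∙ (⌜x⌝ ⊙ ‹W›) = ⌜f⌝ -> Evt W ∙ (‹W› ⊙ ⌜x⌝) = ⌜f⌝.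
Proof.
move=> xf.
have -> : ⌜x⌝ = rmate W^∨ (Cot W) tunit ⌜f⌝.
  rewrite /rmate mtensm1 -flip_coev -xf whiskerr // -mcompA -mtensA -mid_tens.
  rewrite -(interchange_cups (n := Co W) (c := ⌜x⌝)) // mcompA.
  by rewrite (snakeP (left_dual_pair W)) mcomp1m.
by rewrite (rmate_ev (right_dual_pair W)) // mtensm1.
Qed.

Definition Phi X := lmate X^∨^∨ (Co X^∨) X (Evt X).

Lemma Mor_phi X : ⌜phi X⌝ = Phi X.
Proof. by rewrite /phi Mor_eqml Mor_comp Mor_eqml Mor_eqmr. Qed.

Lemma Mor_phiV X : ⌜phiV X⌝ = lmate X (Cot X) X^∨^∨ (Ev X^∨).
Proof. by rewrite /phiV Mor_eqml Mor_comp Mor_eqml Mor_eqmr. Qed.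

(** That phi turns the left evaluation of X into the right evaluation of X^∨ is
    not a formal consequence of the definition of phi, which only relates Evt X
    and Ev X^∨ in this way.  It is [flip_ev] for the element of (X^∨ ⊗ X)^∨
    obtained from coev_{X^∨} by the constraint of the dual functor: the form it
    represents is Ev X for the left duality, and Evt X^∨ ∙ (‹X^∨› ⊙ Phi X) for
    the right one. *)
Lemma Evt_Phi X : Evt X^∨ ∙ (‹X^∨› ⊙ Phi X) = Ev X.
Proof.
pose x := left_dual2 (pdata C) X X^∨ ∘ pcoev X^∨.
have xE : ⌜x⌝ = dual2 X X^∨ ∙ Co X^∨ by rewrite Mor_comp.
have xl : Ev (X^∨ ⊗ X) ∙ (⌜x⌝ ⊙ ‹X^∨ ⊗ X›) = Ev X.
  rewrite xE whiskerr // mcompA dual2_lmate (lmate_ev (left_dual_pair _)) //.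
  rewrite /Ev2 mid_tens !mtensA -mcompA -whiskerr //.
  by rewrite (snakeQ (left_dual_pair _)) -mid_tens mcompm1.
rewrite -[RHS](flip_ev xl) xE whiskerl // mcompA.
rewrite dual2_rmate (rmate_ev (right_dual_pair _)) //.
by rewrite /Evt2 -mcompA mid_tens -mtensA -whiskerl.
Qed.

Lemma Phi_nat X Y (g : hom X Y) :
  ⌜dualm (dualm g)⌝ ∙ Phi X = Phi Y ∙ ⌜g⌝.
Proof.
rewrite /Phi /lmate mcompA -[⌜dualm (dualm g)⌝ in LHS]mtens1m.
rewrite -(interchange (A := X ⊗ X^∨) (B := tunit) (X := X^∨^∨) (Y := Y^∨^∨)) //.
rewrite -mcompA mid_tens -mtensA -whiskerl // dualm_Co whiskerl // mtensA mcompA.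
rewrite -whiskerr // dualm_Evt whiskerr // -!mcompA; congr (_ ∙ _).
rewrite -mtensA -mid_tens.
by rewrite (interchange (g := Co Y^∨) (A := X) (X := tunit) (B := Y)) // mtensm1.
Qed.

Lemma rotate_twice X (g : End X) : phiV X ∘ dualm (dualm g) ∘ phi X = g.
Proof.
apply: Mor_inj; rewrite 2!Mor_comp Mor_phi Phi_nat -Mor_phi mcompA -Mor_comp phiK.
exact: mcomp1m.
Qed.

(** * Partial traces *)

Implicit Types (f h u v b c e th : mor C).

Definition trL X Y Z f := (Ev X ⊙ ‹Z›) ∙ (‹X^∨› ⊙ f) ∙ (Cot X ⊙ ‹Y›).
Definition trR X Y Z f := (‹Z› ⊙ Evt X) ∙ (f ⊙ ‹X^∨›) ∙ (‹Y› ⊙ Co X).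

Lemma Mor_trl X Y Z (f : hom (X ⊗ Y) (X ⊗ Z)) : ⌜trl f⌝ = trL X Y Z ⌜f⌝.
Proof.
by rewrite /trl Mor_eqml Mor_comp Mor_eqml Mor_comp Mor_eqml Mor_eqmr.
Qed.

Lemma Mor_trr X Y Z (f : hom (Y ⊗ X) (Z ⊗ X)) : ⌜trr f⌝ = trR X Y Z ⌜f⌝.
Proof.
by rewrite /trr Mor_eqml Mor_comp Mor_eqml Mor_comp Mor_eqml Mor_eqmr.
Qed.

Lemma trL_nat X Y Z Y' Z' f u v : dom f = X ⊗ Y -> cod f = X ⊗ Z ->
    dom u = Z -> cod u = Z' -> dom v = Y' -> cod v = Y ->
  trL X Y' Z' ((‹X› ⊙ u) ∙ f ∙ (‹X› ⊙ v)) = u ∙ trL X Y Z f ∙ v.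
Proof.
move=> *; rewrite /trL !whiskerl // !mtensA -!mid_tens -!mcompA.
rewrite -(interchange (A := tunit) (B := X^∨ ⊗ X) (X := Y') (Y := Y)) // mcompA.
rewrite (interchange (A := X^∨ ⊗ X) (B := tunit) (X := Z) (Y := Z')) //.
by rewrite !mtens1m -!mcompA.
Qed.

Lemma trL_natl X Y Z Z' f u : dom f = X ⊗ Y -> cod f = X ⊗ Z ->
    dom u = Z -> cod u = Z' ->
  trL X Y Z' ((‹X› ⊙ u) ∙ f) = u ∙ trL X Y Z f.
Proof.
move=> f1 f2 u1 u2; have := trL_nat (v := ‹Y›) f1 f2 u1 u2.
by rewrite -mid_tens mcompm1 // (mcompm1 (f := trL _ _ _ _)) // => ->.
Qed.

Lemma trR_nat X Y Z Y' Z' f u v : dom f = Y ⊗ X -> cod f = Z ⊗ X ->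
    dom u = Z -> cod u = Z' -> dom v = Y' -> cod v = Y ->
  trR X Y' Z' ((u ⊙ ‹X›) ∙ f ∙ (v ⊙ ‹X›)) = u ∙ trR X Y Z f ∙ v.
Proof.
move=> *; rewrite /trR !whiskerr // -!mtensA -!mid_tens -!mcompA.
rewrite (interchange (A := Y') (B := Y) (X := tunit) (Y := X ⊗ X^∨)) // mcompA.
rewrite -(interchange (A := Z) (B := Z') (X := X ⊗ X^∨) (Y := tunit)) //.
by rewrite !mtensm1 -!mcompA.
Qed.

Lemma trL_tensr X Y Z W f : dom f = X ⊗ Y -> cod f = X ⊗ Z ->
  trL X (Y ⊗ W) (Z ⊗ W) (f ⊙ ‹W›) = trL X Y Z f ⊙ ‹W›.
Proof. by move=> *; rewrite /trL !whiskerr // !mid_tens !mtensA. Qed.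

Lemma trR_tensl X Y Z W f : dom f = Y ⊗ X -> cod f = Z ⊗ X ->
  trR X (W ⊗ Y) (W ⊗ Z) (‹W› ⊙ f) = ‹W› ⊙ trR X Y Z f.
Proof. by move=> *; rewrite /trR !whiskerl // !mid_tens !mtensA. Qed.

Lemma trLR A B Y Z f : dom f = A ⊗ Y ⊗ B -> cod f = A ⊗ Z ⊗ B ->
  trL A Y Z (trR B (A ⊗ Y) (A ⊗ Z) f) = trR B Y Z (trL A (Y ⊗ B) (Z ⊗ B) f).
Proof.
move=> *; rewrite /trL /trR !whiskerl // !whiskerr // !mid_tens !mtensA -!mcompA.
have caps : (Ev A ⊙ ‹Z›) ∙ (‹A^∨› ⊙ ‹A› ⊙ ‹Z› ⊙ Evt B)
    = (‹Z› ⊙ Evt B) ∙ (Ev A ⊙ ‹Z› ⊙ ‹B› ⊙ ‹B^∨›).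
  rewrite -[X in X ∙ _]mtensm1 -!mid_tens.
  rewrite (interchange (A := A^∨ ⊗ A ⊗ Z) (B := Z) (X := B ⊗ B^∨)) //.
  by rewrite mid_tens mtensA.
have cups : (‹A^∨› ⊙ ‹A› ⊙ ‹Y› ⊙ Co B) ∙ (Cot A ⊙ ‹Y›)
    = (Cot A ⊙ ‹Y› ⊙ ‹B› ⊙ ‹B^∨›) ∙ (‹Y› ⊙ Co B).
  rewrite -[X in _ ∙ X = _]mtensm1 -!mid_tens.
  rewrite -(interchange (A := Y) (X := tunit) (Y := B ⊗ B^∨)) //.
  by rewrite mid_tens mtensA.
by rewrite mcompA caps cups -!mcompA.
Qed.

(** A morphism u slides around the closed strand: it crosses the cap as its left
    dual and the cup as its right dual, and these agree. *)
Lemma trL_cyc A B Y Z (u : hom B A) h : dom h = A ⊗ Y -> cod h = B ⊗ Z ->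
  trL A Y Z ((⌜u⌝ ⊙ ‹Z›) ∙ h) = trL B Y Z (h ∙ (⌜u⌝ ⊙ ‹Y›)).
Proof.
move=> h1 h2; rewrite /trL !whiskerl // mtensA -!mcompA mcompA -whiskerr //.
rewrite -dualm_Ev whiskerr // -mcompA -mtensA -mid_tens.
rewrite (mcompA _ _ (⌜dualm u⌝ ⊙ _)) (interchange (B := B^∨) (X := A ⊗ Y)) //.
by rewrite -mcompA mid_tens !mtensA -!whiskerr // dualm_Cot.
Qed.

(** The partial trace over W may be computed with any object V in place of W^∨,
    provided that some th : V -> W^∨ turns the cap Ev W into e and the cup c into
    Cot W.  For the cap it suffices that th is the left mate of e, for the cup
    that th is also the right mate of a form b that straightens c.  This is used
    for V = B^∨ ⊗ A^∨ and for V = 1, where the two descriptions of th are the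
    monoidality of the identification of the left and right dual functors. *)
Lemma trL_change_dual V W Y Z e c b th f :
    dom e = V ⊗ W -> cod e = tunit -> dom c = tunit -> cod c = V ⊗ W ->
    dom b = W ⊗ V -> cod b = tunit -> dom f = W ⊗ Y -> cod f = W ⊗ Z ->
    th = lmate W^∨ (Co W) V e -> th = rmate W^∨ (Cot W) V b ->
    (b ⊙ ‹W›) ∙ (‹W› ⊙ c) = ‹W› ->
  trL W Y Z f = (e ⊙ ‹Z›) ∙ (‹V› ⊙ f) ∙ (c ⊙ ‹Y›).
Proof.
move=> e1 e2 c1 c2 b1 b2 f1 f2 thl thr bc.
have cap : Ev W ∙ (th ⊙ ‹W›) = e by rewrite thl (lmate_ev (left_dual_pair W)).
have cup : (th ⊙ ‹W›) ∙ c = Cot W.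
  rewrite thr (rmate_coev (right_dual_pair W) (V := V)) // bc -mid_tens.
  by rewrite mcomp1m.
have [t1 t2] : dom th = V /\ cod th = W^∨ by rewrite thr.
rewrite /trL -cup -cap !whiskerr // -!mcompA; congr (_ ∙ _).
rewrite -!mtensA -!mid_tens [LHS]mcompA [RHS]mcompA; congr (_ ∙ _).
by rewrite -(interchange (B := W^∨) (A := V) (Y := W ⊗ Z) (X := W ⊗ Y)).
Qed.

Lemma trR_change_dual V W Y Z e c b th f :
    dom e = W ⊗ V -> cod e = tunit -> dom c = tunit -> cod c = W ⊗ V ->
    dom b = V ⊗ W -> cod b = tunit -> dom f = Y ⊗ W -> cod f = Z ⊗ W ->
    th = lmate W^∨ (Co W) V b -> th = rmate W^∨ (Cot W) V e ->
    (‹W› ⊙ b) ∙ (c ⊙ ‹W›) = ‹W› ->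
  trR W Y Z f = (‹Z› ⊙ e) ∙ (f ⊙ ‹V›) ∙ (‹Y› ⊙ c).
Proof.
move=> e1 e2 c1 c2 b1 b2 f1 f2 thl thr bc.
have cap : Evt W ∙ (‹W› ⊙ th) = e by rewrite thr (rmate_ev (right_dual_pair W)).
have cup : (‹W› ⊙ th) ∙ c = Co W.
  rewrite thl (lmate_coev (left_dual_pair W) (V := V)) // bc -mid_tens.
  by rewrite mcomp1m.
have [t1 t2] : dom th = V /\ cod th = W^∨ by rewrite thr.
rewrite /trR -cup -cap !whiskerl // -!mcompA; congr (_ ∙ _).
rewrite !mtensA -!mid_tens [LHS]mcompA [RHS]mcompA; congr (_ ∙ _).
by rewrite -(interchange (B := Z ⊗ W) (A := Y ⊗ W) (Y := W^∨) (X := V)).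
Qed.

Lemma trL_tens A B Y Z f : dom f = A ⊗ B ⊗ Y -> cod f = A ⊗ B ⊗ Z ->
  trL (A ⊗ B) Y Z f = trL B Y Z (trL A (B ⊗ Y) (B ⊗ Z) f).
Proof.
move=> f1 f2; have d := dual_pair_tens (right_dual_pair A) (right_dual_pair B).
rewrite (trL_change_dual (V := B^∨ ⊗ A^∨) (e := Ev2 B A) (c := Cot2 B A)
  (b := Evt2 B A) (th := dual2 B A)) //.
- by rewrite /trL !whiskerl // !whiskerr // -!mcompA !mid_tens !mtensA.
- exact: dual2_lmate.
- exact: dual2_rmate.
- exact: snakeP d.
Qed.

Lemma trR_tens A B Y Z f : dom f = Y ⊗ A ⊗ B -> cod f = Z ⊗ A ⊗ B ->
  trR (A ⊗ B) Y Z f = trR A Y Z (trR B (Y ⊗ A) (Z ⊗ A) f).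
Proof.
move=> f1 f2; have d := dual_pair_tens (left_dual_pair B) (left_dual_pair A).
rewrite (trR_change_dual (V := B^∨ ⊗ A^∨) (e := Evt2 B A) (c := Co2 B A)
  (b := Ev2 B A) (th := dual2 B A)) //.
- by rewrite /trR !whiskerl // !whiskerr // -!mcompA !mid_tens !mtensA.
- exact: dual2_lmate.
- exact: dual2_rmate.
- exact: snakeQ d.
Qed.

Lemma trL_unit Y Z f : dom f = Y -> cod f = Z -> trL tunit Y Z f = f.
Proof.
move=> f1 f2.
rewrite (trL_change_dual (V := tunit) (e := ‹tunit›) (c := ‹tunit›)
  (b := ‹tunit›) (th := Co tunit)) //.
- by rewrite !mtens1m mcompm1 // !mcomp1m.
- by rewrite lmate_unit.
- by rewrite rmate_unit.
- by rewrite mtens1m mcomp1m.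
Qed.

Lemma trR_unit Y Z f : dom f = Y -> cod f = Z -> trR tunit Y Z f = f.
Proof.
move=> f1 f2.
rewrite (trR_change_dual (V := tunit) (e := ‹tunit›) (c := ‹tunit›)
  (b := ‹tunit›) (th := Co tunit)) //.
- by rewrite !mtensm1 mcompm1 // !mcomp1m.
- by rewrite lmate_unit.
- by rewrite rmate_unit.
- by rewrite mtens1m mcomp1m.
Qed.

(** The closed-up diagram is a single strand Z that turns back through Z^∨.  Its
    two bends use different dualities, so that a factor Phi Z appears and is
    absorbed by [Evt_Phi]. *)
Lemma trR_bubble Z : trR Z^∨ Z Z (Co Z ∙ Evt Z) = ‹Z›.
Proof.
rewrite /trR whiskerr // -mcompA -/(lmate _ _ _ _) -/(Phi Z).
have -> : (Co Z ⊙ ‹Z^∨^∨›) ∙ Phi Z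
    = (‹Z› ⊙ (‹Z^∨› ⊙ Phi Z)) ∙ (Co Z ⊙ ‹Z›).
  rewrite mtensA -mid_tens -[X in _ ∙ X = _]mtens1m.
  exact: interchange.
by rewrite mcompA -whiskerl // Evt_Phi (snakeQ (left_dual_pair Z)).
Qed.

Lemma trL_bubble Z : trL Z^∨ Z Z (Cot Z ∙ Ev Z) = ‹Z›.
Proof.
have bend : (‹Z^∨^∨› ⊙ Ev Z) ∙ (Cot Z^∨ ⊙ ‹Z›) = Phi Z.
  rewrite -Evt_Phi whiskerl // mtensA -mid_tens -mcompA.
  rewrite -(interchange (f := Cot Z^∨) (A := tunit) (X := Z) (Y := Z^∨^∨)) //.
  by rewrite mcompA (snakeQ (right_dual_pair _)) mtens1m mcomp1m.
rewrite /trL whiskerl // -mcompA bend mcompA -/(lmate _ _ _ _).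
by rewrite -Mor_phi -Mor_phiV -Mor_comp phiK.
Qed.

(** * Spherical traces are cyclic *)

Section Spherical.
Variables (O : C -> Prop) (t : linear_forms O) (ht : is_spherical_trace t).

Lemma spherical_swap_one_sided X X' (hX : O X) (hX' : O X') V W
    (a : hom (V ⊗ X) (X' ⊗ W)) (b : hom (X' ⊗ W) (V ⊗ X)) :
  t hX (trl (b ∘ a)) = t hX' (trr (a ∘ b)).
Proof.
have [f fE] : exists f : End (X' ⊗ W ⊗ X^∨),
    ⌜f⌝ = (⌜a⌝ ⊙ ‹X^∨›) ∙ (‹V› ⊙ (Co X ∙ Evt X)) ∙ (⌜b⌝ ⊙ ‹X^∨›).
  exact: mor_typed.
(* Slide a around the closed strand X' ⊗ W to meet b.  The trace over V ⊗ X then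
   closes V around b ∘ a, and the cap and cup that remain on X bend the result
   into its right dual. *)
have fl : trl f = dualm (trl (b ∘ a)).
  apply: Mor_inj; rewrite Mor_trl fE trL_cyc // -mcompA -whiskerr // trL_tens //.
  rewrite (trL_natl (Z := X ⊗ X^∨)) // trL_tensr // -Mor_comp -Mor_trl -mcompA.
  rewrite dualm_rmate /rmate /trL whiskerl // -mcompA mcompA.
  by rewrite (snakeP (left_dual_pair X)) mcomp1m.
have fr : trr (assoc X' W X^∨ ∘ f ∘ assocV X' W X^∨) = trr (a ∘ b).
  apply: Mor_inj; rewrite !Mor_trr Mor_eqml Mor_eqmr fE trR_tens //.
  rewrite (trR_nat (Y := V ⊗ X) (Z := V ⊗ X)) // trR_tensl // trR_bubble.
  by rewrite -mid_tens mcomp1m // Mor_comp.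
by rewrite -fr -ht fl rotate_twice.
Qed.

Lemma spherical_swap Y X Z Y' X' Z' (hX : O X) (hX' : O X')
    (a : hom (Y ⊗ X ⊗ Z) (Y' ⊗ X' ⊗ Z'))
    (b : hom (Y' ⊗ X' ⊗ Z') (Y ⊗ X ⊗ Z)) :
  t hX (trl (trr (b ∘ a))) = t hX' (trl (trr (a ∘ b))).
Proof.
have [a2 aE] : exists a2 : hom (Y'^∨ ⊗ Y ⊗ X) (X' ⊗ (Z' ⊗ Z^∨)),
    ⌜a2⌝ = (Ev Y' ⊙ ‹X'› ⊙ ‹Z'› ⊙ ‹Z^∨›) ∙ (‹Y'^∨› ⊙ ⌜a⌝ ⊙ ‹Z^∨›)
      ∙ (‹Y'^∨› ⊙ ‹Y› ⊙ ‹X› ⊙ Co Z).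
  exact: mor_typed.
have [b2 bE] : exists b2 : hom (X' ⊗ (Z' ⊗ Z^∨)) (Y'^∨ ⊗ Y ⊗ X),
    ⌜b2⌝ = (‹Y'^∨› ⊙ ‹Y› ⊙ ‹X› ⊙ Evt Z) ∙ (‹Y'^∨› ⊙ ⌜b⌝ ⊙ ‹Z^∨›)
      ∙ (Cot Y' ⊙ ‹X'› ⊙ ‹Z'› ⊙ ‹Z^∨›).
  exact: mor_typed.
(* In b2 ∘ a2 the bends of Z close its right trace, while those of Y' meet in a
   bubble, which the trace over Y'^∨ straightens; in a2 ∘ b2 the roles of Y' and
   Z are exchanged. *)
have -> : trl (trr (b ∘ a)) = trl (b2 ∘ a2).
  apply: Mor_inj; rewrite !Mor_trl Mor_comp trL_tens //; congr trL.
  have -> : ⌜b2⌝ ∙ ⌜a2⌝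
      = (‹Y'^∨› ⊙ ((‹Y› ⊙ ‹X› ⊙ Evt Z) ∙ (⌜b⌝ ⊙ ‹Z^∨›)))
        ∙ ((Cot Y' ∙ Ev Y') ⊙ ‹X' ⊗ Z' ⊗ Z^∨›)
        ∙ (‹Y'^∨› ⊙ ((⌜a⌝ ⊙ ‹Z^∨›) ∙ (‹Y› ⊙ ‹X› ⊙ Co Z))).
    by rewrite aE bE !whiskerl // !whiskerr // -!mcompA !mid_tens !mtensA.
  rewrite (trL_nat (Y := Y' ⊗ (X' ⊗ Z' ⊗ Z^∨)) (Z := Y' ⊗ (X' ⊗ Z' ⊗ Z^∨))) //.
  rewrite trL_tensr // trL_bubble -[‹Y'› ⊙ _]mid_tens mcomp1m // Mor_trr /trR.
  by rewrite Mor_comp whiskerr // !mid_tens -!mcompA.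
have <- : trr (a2 ∘ b2) = trl (trr (a ∘ b)).
  apply: Mor_inj; rewrite Mor_trl !Mor_trr trLR // trR_tens //; congr trR.
  have -> : ⌜a2 ∘ b2⌝
      = (((Ev Y' ⊙ ‹X' ⊗ Z'›) ∙ (‹Y'^∨› ⊙ ⌜a⌝)) ⊙ ‹Z^∨›)
        ∙ (‹Y'^∨ ⊗ Y ⊗ X› ⊙ (Co Z ∙ Evt Z))
        ∙ (((‹Y'^∨› ⊙ ⌜b⌝) ∙ (Cot Y' ⊙ ‹X' ⊗ Z'›)) ⊙ ‹Z^∨›).
    rewrite Mor_comp aE bE !whiskerl // !whiskerr // -!mcompA.
    by rewrite !mid_tens !mtensA.
  rewrite (trR_nat (Y := Y'^∨ ⊗ Y ⊗ X ⊗ Z) (Z := Y'^∨ ⊗ Y ⊗ X ⊗ Z)) //.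
  rewrite trR_tensl // trR_bubble -[_ ⊙ ‹Z›]mid_tens mcomp1m //.
  by rewrite /trL Mor_comp whiskerl // -!mcompA.
exact: spherical_swap_one_sided.
Qed.

End Spherical.

(** * The extension to the generated ideal *)

Lemma trl_linear X Y Z : linear (@trl k C X Y Z).
Proof.
by move=> a f g; rewrite /trl tensm_linearr !(comp_linearl, comp_linearr).
Qed.

Lemma trr_linear X Y Z : linear (@trr k C X Y Z).
Proof.
by move=> a f g; rewrite /trr tensm_linearl !(comp_linearl, comp_linearr).
Qed.

Lemma scalar_bundle (M : lmodType k) (f : M -> k) :
  scalar f -> exists F : {scalar M}, F =1 f.
Proof.
move=> lf; pose F : {scalar M} := HB.pack f (GRing.isLinear.Build k M k _ f lf).
by exists F.
Qed.

Section Extension.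
Variables (O : C -> Prop) (t : linear_forms O).
Implicit Type U : C.

(** The value at f forced on a trace extending t by a presentation (p, q) of U
    as a retract of Y ⊗ X ⊗ Z. *)
Definition tr_via Y X Z U (hX : O X) (p : hom (Y ⊗ X ⊗ Z) U)
    (q : hom U (Y ⊗ X ⊗ Z)) (f : End U) : k :=
  t hX (trl (trr (q ∘ f ∘ p))).

Lemma tr_via_linear Y X Z U (hX : O X) (p : hom (Y ⊗ X ⊗ Z) U)
  (q : hom U (Y ⊗ X ⊗ Z)) : scalar (tr_via hX p q).
Proof.
move=> a f g; rewrite /tr_via !(comp_linearl, comp_linearr).
by rewrite trr_linear trl_linear linearP.
Qed.

(** Cyclicity, and for U = V and h = id_U also independence of the presentation,
    is [spherical_swap] for the transition morphisms between the two objects of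
    which U and V are retracts. *)
Lemma tr_via_cyclic (ht : is_spherical_trace t)
    Y X Z U Y' X' Z' V (hX : O X) (hX' : O X')
    (p : hom (Y ⊗ X ⊗ Z) U) (q : hom U (Y ⊗ X ⊗ Z))
    (p' : hom (Y' ⊗ X' ⊗ Z') V) (q' : hom V (Y' ⊗ X' ⊗ Z'))
    (g : hom U V) (h : hom V U) :
    p ∘ q = idm U -> p' ∘ q' = idm V ->
  tr_via hX' p' q' (g ∘ h) = tr_via hX p q (h ∘ g).
Proof.
move=> pq pq'; rewrite /tr_via.
have -> : q' ∘ (g ∘ h) ∘ p' = (q' ∘ g ∘ p) ∘ (q ∘ h ∘ p').
  by rewrite !compA -(compA _ p q) pq compm1.
rewrite (spherical_swap ht); congr (t hX (trl (trr _))).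
by rewrite !compA -(compA _ p' q') pq' compm1.
Qed.

Lemma trace_extension (ht : is_spherical_trace t) :
  exists tt : linear_forms (gen_ideal O),
    forall Y X Z U (hX : O X) (p : hom (Y ⊗ X ⊗ Z) U) (q : hom U (Y ⊗ X ⊗ Z))
      (hU : gen_ideal O U), p ∘ q = idm U -> tt U hU =1 tr_via hX p q.
Proof.
have ex U (hU : gen_mem O U) : exists T : {scalar End U},
    forall Y X Z (hX : O X) (p : hom (Y ⊗ X ⊗ Z) U) (q : hom U (Y ⊗ X ⊗ Z)),
      p ∘ q = idm U -> T =1 tr_via hX p q.
  have [Y [X [Z [hX [p [q pq]]]]]] := hU.
  have [T TE] := scalar_bundle (tr_via_linear hX p q).
  exists T => Y' X' Z' hX' p' q' pq' f; rewrite TE -(compm1 f).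
  by rewrite (tr_via_cyclic ht hX' hX _ _ pq' pq) compm1 comp1m.
exists (fun U hU => projT1 (cid (ex U hU))) => Y X Z U hX p q hU.
by case: cid => T /= TE; exact: TE.
Qed.

End Extension.
End Pivotal.

Theorem theorem13 (k : comPzRingType) (C : pivotal_category k)
  (O : C -> Prop) (t : linear_forms O) (ht : is_spherical_trace t) :
  exists tt : linear_forms (gen_ideal O),
    [/\ is_trace tt,
        (forall X (hX : O X), tt X (gen_ideal_sub hX) =1 t X hX)
      & forall tt' : linear_forms (gen_ideal O),
          is_trace tt' ->
          (forall X (hX : O X), tt' X (gen_ideal_sub hX) =1 t X hX) ->
          forall X (hX : gen_ideal O X), tt' X hX =1 tt X hX].
Proof.
have [tt ttE] := trace_extension ht.
exists tt; split.
- split.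
  + move=> U V hU hV g h.
    have [Y [X [Z [hX [p [q pq]]]]]] := hU.
    have [Y' [X' [Z' [hX' [p' [q' pq']]]]]] := hV.
    rewrite (ttE _ _ _ _ hX p q) // (ttE _ _ _ _ hX' p' q') //.
    exact: (tr_via_cyclic ht).
  + move=> U Y hU f.
    have [A [X [Z [hX [p [q pq]]]]]] := hU.
    (* A presentation of U by A ⊗ X ⊗ Z induces one of Y ⊗ U by
       (Y ⊗ A) ⊗ X ⊗ Z. *)
    have [p2 p2E] : exists p2 : hom (Y ⊗ A ⊗ X ⊗ Z) (Y ⊗ U), ⌜p2⌝ = ‹Y› ⊙ ⌜p⌝.
      exact: mor_typed.
    have [q2 q2E] : exists q2 : hom (Y ⊗ U) (Y ⊗ A ⊗ X ⊗ Z), ⌜q2⌝ = ‹Y› ⊙ ⌜q⌝.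
      exact: mor_typed.
    have pq2 : p2 ∘ q2 = idm (Y ⊗ U).
      apply: Mor_inj; rewrite Mor_comp p2E q2E -whiskerl //.
      by rewrite -Mor_comp pq -mid_tens.
    rewrite (ttE _ _ _ _ hX p q) // (ttE _ _ _ _ hX p2 q2) //.
    congr (t _ hX _); apply: Mor_inj; rewrite !Mor_trl !Mor_trr trL_tens //.
    rewrite (Mor_comp q2) (Mor_comp f) p2E q2E !(tensA Y) (trLR (A := Y)) //.
    by rewrite (trL_nat (Y := U) (Z := U)) // -Mor_trl -!Mor_comp.
  + move=> U Y hU f.
    have [A [X [Z [hX [p [q pq]]]]]] := hU.
    have [p2 p2E] :
        exists p2 : hom (A ⊗ X ⊗ (Z ⊗ Y)) (U ⊗ Y), ⌜p2⌝ = ⌜p⌝ ⊙ ‹Y›.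
      exact: mor_typed.
    have [q2 q2E] :
        exists q2 : hom (U ⊗ Y) (A ⊗ X ⊗ (Z ⊗ Y)), ⌜q2⌝ = ⌜q⌝ ⊙ ‹Y›.
      exact: mor_typed.
    have pq2 : p2 ∘ q2 = idm (U ⊗ Y).
      apply: Mor_inj; rewrite Mor_comp p2E q2E -whiskerr //.
      by rewrite -Mor_comp pq -mid_tens.
    rewrite (ttE _ _ _ _ hX p q) // (ttE _ _ _ _ hX p2 q2) //.
    congr (t _ hX (trl _)); apply: Mor_inj; rewrite !Mor_trr trR_tens //.
    rewrite (Mor_comp q2) (Mor_comp f) p2E q2E.
    by rewrite (trR_nat (Y := U) (Z := U)) // -Mor_trr -!Mor_comp.
- move=> X hX f.
  have [p pE] : exists p : hom (tunit ⊗ X ⊗ tunit) X, ⌜p⌝ = ‹X›.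
    exact: mor_typed.
  have [q qE] : exists q : hom X (tunit ⊗ X ⊗ tunit), ⌜q⌝ = ‹X›.
    exact: mor_typed.
  have pq : p ∘ q = idm X by apply: Mor_inj; rewrite Mor_comp pE qE mcompm1.
  rewrite (ttE _ _ _ _ hX p q) //; congr (t _ hX _); apply: Mor_inj.
  rewrite Mor_trl Mor_trr 2!Mor_comp pE qE mcompm1 // mcomp1m // trR_unit //.
  by rewrite trL_unit.
- move=> tt' [cyc trlE trrE] tE U hU f.
  have [Y [X [Z [hX [p [q pq]]]]]] := hU.
  rewrite (ttE _ _ _ _ hX p q) // /tr_via -tE -trlE -trrE.
  rewrite -[f in LHS]comp1m -pq -[(p ∘ q) ∘ f]compA.
  pose hW := ideal_tensr Z (ideal_tensl Y (gen_ideal_sub hX)).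
  by rewrite (cyc _ _ hW) -compA.
Qed.
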